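(* Suppose that Alice and Bob have access to a common clock. There are absolute constants $C,c>0$ such that for all $p_1,p_2,q\in(0,1]$: there are (not necessarily stationary) strategies for Alice and Bob achieving $$\mathbb{E}X\le \frac{C}{\min\{p_1,p_2\}\,q},$$ and every choice of strategies by Alice and Bob satisfies $$\mathbb{E}X\ge \frac{c}{\min\{p_1,p_2\}\,q}.$$
   Context: Synchronization problem. Channels are indexed by $\mathbb{N}=\{1,2,\ldots\}$. Let $p_1,p_2,q\in(0,1]$. The environments are $A=(A_i)_{i\in\mathbb N}$ (Alice), $B=(B_i)_{i\in\mathbb N}$ (Bob), $E=(E_i)_{i\in\mathbb N}$ (Eve), where all the variables $A_i,B_i,E_i$ are mutually independent Bernoulli variables with $\mathbb{P}(A_i=1)=p_1$, $\mathbb{P}(B_i=1)=p_2$, $\mathbb{P}(E_i=1)=q$. The value $1$ means that the channel is open in that environment. The environments do not change over time. Strategies with a common clock. In each time slot $t\ge1$ each party selects one channel, possibly at random. Alice knows $A$ but not $B,E$; Bob knows $B$ but not $A,E$. There is no feedback before synchronization, so strategies are non-adaptive: Alice's strategy assigns to each realization of $A$ the law of a random sequence of channels $(a_t)_{t\ge1}$, and Bob's strategy assigns to each realization of $B$ the law of a random sequence of channels $(b_t)_{t\ge1}$. The parties use independent private randomness, so that, conditionally on $(A,B,E)$, the sequences $(a_t)$ and $(b_t)$ are independent, the law of $(a_t)$ depends only on $A$ and the law of $(b_t)$ depends only on $B$. Having a common clock means that both parties use the same time index $t$ (they start at the same time), and the law of the channel selected by a party may vary with $t$, i.e. strategies need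 not be stationary (a strategy is stationary if this law is the same for all $t$). Synchronization time. The parties synchronize at time $t\ge1$ if $a_t=b_t=j$ for some channel $j$ with $A_j=B_j=E_j=1$. The synchronization time $X$ is the first such $t$ ($X=\infty$ if there is none). $\mathbb{E}X$ is the expectation over $A,B,E$ and over the randomness of the strategies. *)

(* Defs.v *)
From HB Require Import structures.
From mathcomp Require Import all_boot all_order all_algebra.
From mathcomp Require Import all_classical all_reals all_analysis measurable_realfun.

Set Implicit Arguments.
Unset Strict Implicit.
Unset Printing Implicit Defensive.

Import Order.TTheory GRing.Theory Num.Theory.

Local Open Scope classical_set_scope.
Local Open Scope ring_scope.

(* Channels are indexed from 0 instead of 1, and so are time slots: slot t (for
   t >= 1) has index t.-1.  The shift of the time index is undone in
   [sync_time]; channel labels play no role. *)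

Definition cylinders d (T : measurableType d) : set (set (nat -> T)) :=
  [set S | exists i (Y : set T), measurable Y /\ S = [set f | Y (f i)]].

(* T^nat with the product sigma-algebra *)
Definition seq_space d (T : measurableType d) : Type :=
  g_sigma_algebraType (@cylinders d T).

HB.instance Definition _ d (T : measurableType d) :=
  Measurable.copy (seq_space T) (g_sigma_algebraType (@cylinders d T)).

(* Realizations of an environment; [true] means that the channel is open. *)
Definition env_space : Type := seq_space bool.

(* Sequences of channels selected by a party *)
Definition chan_space : Type := seq_space nat.

HB.instance Definition _ := Measurable.on env_space.
HB.instance Definition _ := Measurable.on chan_space.

(* The law of the sequence of selected channels, given the realization of the
   party's own environment; nothing relates the laws of different slots. *)
Definition strategy (R : realType) := R.-pker env_space ~> chan_space.

(* The kernel at a point, packaged as a probability measure so that the product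
   [\x] of two such laws is recognized as a measure. *)
Section strategy_law.
Context (R : realType) (s : strategy R) (x : env_space).

Definition strategy_law : set chan_space -> \bar R := s x.

HB.instance Definition _ := Measure.on strategy_law.

Let strategy_law_setT : strategy_law [set: chan_space] = 1%E.
Proof. exact: prob_kernel. Qed.

HB.instance Definition _ :=
  Measure_isProbability.Build _ _ _ strategy_law strategy_law_setT.

End strategy_law.

Definition mutually_independent d (Omega : measurableType d) (R : realType)
    (P : probability Omega R) (I : eqType) d' (T : measurableType d')
    (X : I -> {RV P >-> T}) : Prop :=
  forall (s : seq I) (Y : I -> set T), uniq s -> (forall i, measurable (Y i)) ->
    P (\bigcap_(i in [set` s]) (X i @^-1` Y i))
      = (\prod_(i <- s) P (X i @^-1` Y i))%E.

(* The family of all variables A_i, B_i, E_i *)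
Definition env_family d (Omega : measurableType d) (R : realType)
    (P : probability Omega R) (A B E : nat -> {RV P >-> bool})
    (k : nat + nat + nat) : {RV P >-> bool} :=
  match k with
  | inl (inl i) => A i
  | inl (inr i) => B i
  | inr i => E i
  end.

Definition bernoulli_environments d (Omega : measurableType d) (R : realType)
    (P : probability Omega R) (p1 p2 q : R)
    (A B E : nat -> {RV P >-> bool}) : Prop :=
  [/\ mutually_independent (env_family A B E),
      forall i, P [set w | A i w = true] = p1%:E,
      forall i, P [set w | B i w = true] = p2%:E &
      forall i, P [set w | E i w = true] = q%:E].

Definition env_at d (Omega : measurableType d) (R : realType)
    (P : probability Omega R) (A : nat -> {RV P >-> bool}) (w : Omega)
    : env_space := fun i => A i w.

Definition sync_at (A B E : env_space) (a b : chan_space) (t : nat) : Prop :=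
  exists j, [/\ a t = j, b t = j & [/\ A j = true, B j = true & E j = true]].

(* The infimum of the empty set is +oo. *)
Definition sync_time (R : realType) (A B E : env_space) (a b : chan_space)
    : \bar R :=
  ereal_inf [set (t.+1%:R)%:E | t in sync_at A B E a b].

(* E X: conditionally on the environments, the pair of channel sequences has
   the product of the laws prescribed by the two strategies. *)
Definition expected_sync_time d (Omega : measurableType d) (R : realType)
    (P : probability Omega R) (A B E : nat -> {RV P >-> bool})
    (sA sB : strategy R) : \bar R :=
  (\int[P]_w \int[strategy_law sA (env_at A w) \x strategy_law sB (env_at B w)]_ab
     sync_time R (env_at A w) (env_at B w) (env_at E w) ab.1 ab.2)%E.

(* Main.v *)
(* Lower bound: conditionally on Alice's environment, the channel a_t is
   independent of (B, E), so it is open for Bob and for Eve with probability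
   p2 q, whatever the strategies; symmetrically for b_t.  Hence each slot
   succeeds with probability at most u := min(p1, p2) q, and
   E X >= (N + 1) (1 - N u) with N of order 1 / (2 u).
   Upper bound: arrange the channels in infinitely many infinite rows.  In slot
   t each party selects its first open channel of row t.  These agree on a
   channel that is open for Eve with probability
   p1 p2 q / (p1 + p2 - p1 p2) >= u / 2, independently over the slots.  Keeping
   only finitely many terms of the geometric series gives at least u / 4. *)
From HB Require Import structures.
Require Import Defs.
From mathcomp Require Import all_boot all_order all_algebra.
From mathcomp Require Import all_classical all_reals all_analysis measurable_realfun.
From mathcomp Require Import ring lra.

Set Implicit Arguments.
Unset Strict Implicit.
Unset Printing Implicit Defensive.

Import Order.TTheory GRing.Theory Num.Theory.

Local Open Scope classical_set_scope.
Local Open Scope ring_scope.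

(** * Independence of sigma-algebras generated by disjoint families of variables *)

Section independence.
Context d (Omega : measurableType d) (R : realType) (P : probability Omega R).

Definition independent_events (F U : set Omega) : Prop :=
  P (F `&` U) = (P F * P U)%E.

(** The events independent of [U] form a Dynkin system, so independence passes from a pi-system to
    the sigma-algebra it generates. *)
Lemma independent_events_sigma (G : set (set Omega)) (U : set Omega) :
  setI_closed G -> G `<=` measurable -> measurable U ->
  (forall F, G F -> independent_events F U) ->
  forall F, <<s G >> F -> independent_events F U.
Proof.
move=> GI Gm mU GU F; rewrite -(setI_closed_g_dynkin_g_sigma_algebra GI) => sF.
suff: [set F | measurable F /\ independent_events F U] F by case.
apply: sF; split; last by move=> A GA; split; [exact: Gm|exact: GU].
split.
- split; first exact: measurableT.
  by rewrite /independent_events setTI probability_setT mul1e.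
- move=> A [mA AU]; split; first exact: measurableC.
  rewrite /independent_events setIC -setDE measureD//; last first.
    by rewrite ltey_eq fin_num_measure.
  transitivity (P U - P A * P U)%E.
    by rewrite (setIC U); congr (_ - _)%E; exact: AU.
  by rewrite probability_setC// muleBl ?fin_num_measure ?mul1e.
- move=> A tA AU; split; first by apply: bigcup_measurable => i _; case: (AU i).
  rewrite /independent_events setI_bigcupl !measure_bigcup//; last 3 first.
  + by move=> i _; case: (AU i).
  + by move=> i _; apply: measurableI => //; case: (AU i).
  + by under eq_fun do rewrite setIC; exact: trivIset_setIl.
  have PUE : P U = (fine (P U))%:E by rewrite fineK ?fin_num_measure.
  rewrite muleC PUE -nneseriesZl//.
  by apply: eq_eseriesr => i _; rewrite -PUE muleC; case: (AU i).
Qed.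

Context (I : choiceType) d' (T : measurableType d') (X : I -> {RV P >-> T}).

(** Finite-dimensional events constraining only variables with index in [K]: a pi-system that
    generates the sigma-algebra of these variables. *)
Definition rectangles (K : set I) : set (set Omega) :=
  [set F | exists (s : seq I) (Y : I -> set T),
    [/\ uniq s, [set` s] `<=` K, forall i, measurable (Y i) &
        F = \bigcap_(i in [set` s]) (X i @^-1` Y i)]].

Lemma measurable_rectangles K : rectangles K `<=` measurable.
Proof.
move=> _ [s [Y [_ _ mY ->]]]; rewrite bigcap_seq.
apply: bigsetI_measurable => i _.
by rewrite -[X in measurable X]setTI; exact: measurable_funP.
Qed.

Lemma sigma_rectangles_measurable K : <<s rectangles K >> `<=` measurable.
Proof.
apply: smallest_sub; first exact: sigma_algebra_measurable.
exact: measurable_rectangles.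
Qed.

Lemma setI_closed_rectangles K : setI_closed (rectangles K).
Proof.
move=> _ _ [s1 [Y1 [_ s1K mY1 ->]]] [s2 [Y2 [_ s2K mY2 ->]]].
(* The two lists may share indices, so they are merged without repetition; a list that omits an
   index constrains it by [setT]. *)
exists (undup (s1 ++ s2)), (fun i => (if i \in s1 then Y1 i else setT) `&`
  (if i \in s2 then Y2 i else setT)); split.
- exact: undup_uniq.
- move=> i /=; rewrite mem_undup mem_cat => /orP[]; [exact: s1K|exact: s2K].
- by move=> i; apply: measurableI; case: ifP.
- apply/seteqP; split => w /=.
    by move=> [w1 w2] i _; split; case: ifPn => // si; [exact: w1|exact: w2].
  move=> w12; split => i /= si.
    have /w12[+ _] : i \in undup (s1 ++ s2) by rewrite mem_undup mem_cat si.
    by rewrite si.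
  have /w12[_ +] : i \in undup (s1 ++ s2) by rewrite mem_undup mem_cat si orbT.
  by rewrite si.
Qed.

Hypothesis indepX : mutually_independent X.

(** Disjointness of [K] and [L] makes the concatenated list duplicate-free, so mutual independence
    factors the joint event over it. *)
Lemma independent_rectangles K L F U : K `&` L = set0 ->
  rectangles K F -> rectangles L U -> independent_events F U.
Proof.
move=> KL [s [Y [us sK mY ->]]] [r [Z [ur rL mZ ->]]].
have sr i : i \in r -> i \notin s.
  move=> ir; apply/negP => si; suff: (K `&` L) i by rewrite KL.
  by split; [exact: sK|exact: rL].
rewrite /independent_events.
rewrite [X in P X](_ : _ = \bigcap_(i in [set` s ++ r])
    X i @^-1` (if i \in s then Y i else Z i)); last first.
  apply/seteqP; split => w /=.
    move=> [w1 w2] i /=; rewrite mem_cat => /orP[si|ri].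
      by rewrite si; exact: w1.
    by rewrite (negbTE (sr _ ri)); exact: w2.
  move=> w12; split => i /= si; have := w12 i; rewrite /= mem_cat si ?orbT.
    by move=> /(_ erefl).
  by rewrite (negbTE (sr _ si)) => /(_ erefl).
rewrite !indepX//; last 2 first.
- rewrite cat_uniq us ur andbT/=; apply/hasPn => i; exact: sr.
- by move=> i; case: ifP.
rewrite big_cat/=; congr (_ * _)%E; apply: eq_big_seq => i si.
  by rewrite si.
by rewrite (negbTE (sr _ si)).
Qed.

(* Dynkin's pi-lambda theorem, once for each factor. *)
Lemma independent_sigma_rectangles K L F U : K `&` L = set0 ->
  <<s rectangles K >> F -> <<s rectangles L >> U -> independent_events F U.
Proof.
move=> KL sF sU.
apply: (independent_events_sigma (@setI_closed_rectangles K)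
  (@measurable_rectangles K) _ _ sF).
  exact: sigma_rectangles_measurable sU.
move=> F' F'K; rewrite /independent_events setIC muleC.
apply: (independent_events_sigma (@setI_closed_rectangles L)
  (@measurable_rectangles L) _ _ sU).
  exact: measurable_rectangles F'K.
move=> U' U'L; rewrite /independent_events setIC muleC.
exact: independent_rectangles F'K U'L.
Qed.

Lemma rectangles_preimage (K : set I) i Y : K i -> measurable Y ->
  rectangles K (X i @^-1` Y).
Proof.
move=> Ki mY; exists [:: i], (fun=> Y); split => //.
  by move=> j /=; rewrite inE => /eqP ->.
by apply/seteqP; split => w /=; [move=> Xw j/=; rewrite inE => /eqP ->|
  apply; rewrite /= inE].
Qed.

End independence.

(** * Integration over an independent event *)

Section independent_integral.
Local Open Scope ereal_scope.
Context d (Omega : measurableType d) (R : realType) (P : probability Omega R).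

(** By independence, [P] restricted to [U] and [P] scaled by [P U] have the same pushforward by
    [phi], hence give [g] the same integral. *)
Lemma independent_integral d' (S : measurableType d') (phi : Omega -> S)
    (U : set Omega) (g : S -> \bar R) :
  measurable_fun setT phi -> measurable U ->
  (forall B, measurable B -> independent_events P (phi @^-1` B) U) ->
  measurable_fun setT g -> (forall x, 0 <= g x) ->
  \int[P]_(w in U) g (phi w) = P U * \int[P]_w g (phi w).
Proof.
move=> mphi mU ind mg g0.
have mgf D : measurable_fun D (g \o phi).
  by apply: measurable_funTS; exact: measurableT_comp.
have u0 : (0 <= fine (P U))%R by exact: fine_ge0.
transitivity (\int[mrestr P mU]_(w in U) g (phi w)).
  by apply: eq_measure_integral => A mA AU; rewrite /= /mrestr setIidl.
transitivity (\int[mrestr P mU]_w g (phi w)).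
  rewrite [RHS](@ge0_negligible_integral _ _ _ _ _ (~` U)) ?setTD ?setCK//.
  - exact: measurableC.
  - by rewrite /= /mrestr setICl measure0.
have gT : {in setT, forall x, 0 <= g x} by move=> x _; exact: g0.
have := ge0_integral_pushforward mphi P measurableT mg gT.
have := ge0_integral_pushforward mphi (mrestr P mU) measurableT mg gT.
rewrite preimage_setT /comp => <- <-.
rewrite -(fineK (fin_num_measure P U mU)) -[fine _]/((NngNum u0)%:num).
rewrite -ge0_integral_mscale//; apply: eq_measure_integral => A mA _.
rewrite /= /mscale /pushforward /mrestr /= fineK ?fin_num_measure//.
by rewrite muleC; exact: ind.
Qed.

(* [ge0_le_integral] asks for measurability, which is not available for
   [w |-> E(X | w)] without a joint-measurability argument; the integral being
   a supremum, monotonicity does not need it. *)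
Lemma ge0_le_integral_nonmeasurable d' (T : measurableType d')
    (mu : {measure set T -> \bar R}) (f g : T -> \bar R) :
  (forall x, 0 <= f x) -> (forall x, f x <= g x) ->
  \int[mu]_x f x <= \int[mu]_x g x.
Proof.
move=> f0 fg; rewrite !ge0_integralTE//; last first.
  by move=> x; exact: le_trans (fg x).
apply: le_ereal_sup => _ [h hf <-]; exists h => // x.
exact: le_trans (fg x).
Qed.

End independent_integral.

(** * Openness of a selected channel in the environments unknown to the party *)

Section selected_channel.
Context d (Omega : measurableType d) (R : realType) (P : probability Omega R).
Local Open Scope ereal_scope.

Lemma measurable_seq_space_coord d' (T : measurableType d') i (Y : set T) :
  measurable Y -> measurable ([set f | Y (f i)] : set (seq_space T)).
Proof. by move=> mY; apply: sub_sigma_algebra; exists i, Y. Qed.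

Lemma measurable_chan (t j : nat) :
  measurable ([set a | a t = j] : set chan_space).
Proof. exact: (@measurable_seq_space_coord _ nat t [set j]). Qed.

(** Preimages of cylinders are rectangles, and the sets whose preimage lies in a given sigma-algebra
    form a sigma-algebra. The map [c] picks one environment out of a joint family. *)
Lemma sigma_env_at (I : choiceType) (X : I -> {RV P >-> bool}) (c : nat -> I)
    (K : set I) (S : set env_space) :
  (forall i, K (c i)) -> measurable S ->
  <<s rectangles X K >> (env_at (fun i => X (c i)) @^-1` S).
Proof.
move=> cK.
have := @sigma_algebra_image _ _ setT (env_at (fun i => X (c i))) _
  (smallest_sigma_algebra setT (rectangles X K)).
move=> sI mS; have : image_set_system setT (env_at (fun i => X (c i)))
    <<s rectangles X K >> S.
  move: S mS; apply: smallest_sub => // _ [i [Y [mY ->]]].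
  rewrite /image_set_system/= setTI.
  apply: sub_sigma_algebra.
  exact: (@rectangles_preimage _ _ _ _ _ _ _ X K (c i)).
by rewrite /image_set_system/= setTI.
Qed.

Lemma measurable_env_at (X : nat -> {RV P >-> bool}) :
  measurable_fun setT (env_at X).
Proof.
move=> _ S mS; rewrite setTI.
apply: (@sigma_rectangles_measurable _ _ _ P _ _ _ X setT).
exact: (@sigma_env_at _ X id).
Qed.

(** Split according to the selected channel [j]. The probability of selecting [j] is a function of
    the party's environment, hence independent of [U j]; the terms [u] times the mean probability of
    selecting [j] add up to [u]. *)
Lemma integral_selected_channel (s : strategy R) (X : nat -> {RV P >-> bool})
    (U : nat -> set Omega) (u : \bar R) (t : nat) :
  (forall j, measurable (U j)) -> (forall j, P (U j) = u) ->
  (forall j B, measurable B -> independent_events P (env_at X @^-1` B) (U j)) ->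
  measurable_fun setT (fun w => s (env_at X w) [set a | U (a t) w]) /\
  \int[P]_w s (env_at X w) [set a | U (a t) w] = u.
Proof.
move=> mU PU ind.
pose g j x := s x [set a : chan_space | a t = j].
have mg j : measurable_fun setT (g j).
  exact: measurable_kernel (measurable_chan t j).
have g0 j x : 0 <= g j x by exact: measure_ge0.
pose h j := (fun w => g j (env_at X w)) \_ (U j).
have mh j : measurable_fun setT (h j).
  apply/(measurable_restrictT _ (mU j)).1/measurable_funTS.
  by apply: measurableT_comp => //; exact: measurable_env_at.
have h0 j w : 0 <= h j w by rewrite /h patchE; case: ifP.
have split_t x : 1 = \sum_(j <oo) g j x.
  rewrite -[LHS](@prob_kernel _ _ _ _ _ s x).
  rewrite (_ : setT = \bigcup_j [set a : chan_space | a t = j]).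
    rewrite measure_bigcup//; first by apply: eq_eseriesl => j; rewrite in_setT.
      by move=> j _; exact: measurable_chan.
    by move=> i j _ _ [a [/= <- <-]].
  by apply/seteqP; split => a //= _; exists (a t).
pose sel w := s (env_at X w) [set a | U (a t) w].
have selE : sel = fun w => \sum_(j <oo) h j w.
  apply/funext => w; rewrite /sel.
  rewrite (_ : [set a | U (a t) w] = \bigcup_(j in [set j | U j w])
      [set a : chan_space | a t = j]).
    rewrite measure_bigcup//; last 2 first.
    - by move=> j _; exact: measurable_chan.
    - by move=> i j _ _ [a [/= <- <-]].
    rewrite eseries_mkcond; apply: eq_eseriesr => j _.
    rewrite /h patchE (_ : (j \in [set k | U k w]) = (w \in U j))//.
  by apply/seteqP; split => [a /= Ua|a [j /= + ->]//]; exists (a t).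
change (measurable_fun setT sel /\ \int[P]_w sel w = u); rewrite selE.
split; first by apply: (ge0_emeasurable_sum (P := xpredT)) => //.
rewrite integral_nneseries//.
have hE j : \int[P]_w h j w = u * \int[P]_w g j (env_at X w).
  rewrite -integral_mkcond -(PU j).
  apply: independent_integral => //; first exact: measurable_env_at.
  by move=> B; exact: ind.
under eq_eseriesr do rewrite hE.
(* Being a probability, [u] is finite and can be pulled out of the series. *)
have -> : u = (fine u)%:E by rewrite -(PU 0%N) fineK ?fin_num_measure.
rewrite nneseriesZl; last by move=> j _; exact: integral_ge0.
rewrite -integral_nneseries//; last first.
  by move=> j; apply: measurableT_comp => //; exact: measurable_env_at.
under eq_integral do rewrite -split_t.
rewrite (integral_cst P measurableT 1) mul1e.
by rewrite [X in _ * X]probability_setT mule1.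
Qed.

End selected_channel.

Lemma measurable_sync_at (A B E : env_space) (t : nat) :
  measurable [set ab : chan_space * chan_space | sync_at A B E ab.1 ab.2 t].
Proof.
rewrite (_ : [set _ | _] = \bigcup_(j in [set j | [/\ A j, B j & E j]])
    ([set a : chan_space | a t = j] `*` [set b : chan_space | b t = j])).
  apply: bigcup_measurable => j _.
  by apply: measurableX; exact: measurable_chan.
apply/seteqP; split => [[a b]|[a b]] /=.
  by move=> [j [<- ab [Aj Bj Ej]]]; exists (a t).
by move=> [j [Aj Bj Ej] [/= aj bj]]; exists j.
Qed.

(** * Lower bound on the expected time from a bound on each slot *)

Section lower_bound.
Local Open Scope ereal_scope.
Context d (Omega : measurableType d) (R : realType) (P : probability Omega R).
Context (A B E : nat -> {RV P >-> bool}) (sA sB : strategy R).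

Let mu w := strategy_law sA (env_at A w) \x strategy_law sB (env_at B w).
Let sync w t := [set ab : chan_space * chan_space |
  sync_at (env_at A w) (env_at B w) (env_at E w) ab.1 ab.2 t].

Let msync w t : measurable (sync w t). Proof. exact: measurable_sync_at. Qed.

Lemma product_strategy_lawE w (F G : set chan_space) :
  measurable F -> measurable G ->
  mu w (F `*` G) = sA (env_at A w) F * sB (env_at B w) G.
Proof. by move=> mF mG; rewrite /mu product_measure1E. Qed.

(** A Markov-type bound: without synchronization in the slots of index [0] to [N - 1], that is at
    times [1] to [N], the synchronization time is at least [N + 1]. *)
Lemma sync_time_tail w N :
  N.+1%:R%:E * mu w (~` \big[setU/set0]_(t < N) sync w t) <=
  \int[mu w]_ab
    sync_time R (env_at A w) (env_at B w) (env_at E w) ab.1 ab.2.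
Proof.
set S := ~` _.
have mS : measurable S.
  by apply: measurableC; apply: bigsetU_measurable => t _; exact: msync.
rewrite -(integral_cst (mu w) mS) integral_mkcond.
apply: ge0_le_integral_nonmeasurable => -[a b]; rewrite patchE;
  case: ifPn => //.
- by move=> _; rewrite lee_fin.
- move=> /set_mem abS; apply: le_ereal_inf_tmp => _ [t st <-].
  rewrite lee_fin ler_nat ltnNge; apply/negP => tN; apply: abS.
  by rewrite -bigcup_mkord; exists t.
- by move=> _; apply: le_ereal_inf_tmp => _ [t st <-]; rewrite lee_fin.
Qed.

(** Union bound over the first [N] slots, averaged over the environments. The measurable majorants
    [h t] stand in for the conditional success probabilities, whose measurability in [w] is not
    established. *)
Lemma expected_sync_time_ge (h : nat -> Omega -> \bar R) (u : R) N :
  (forall t, measurable_fun setT (h t)) ->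
  (forall t w, mu w (sync w t) <= h t w) ->
  (forall t, \int[P]_w h t w = u%:E) ->
  (N.+1%:R * (1 - N%:R * u))%:E <= expected_sync_time A B E sA sB.
Proof.
move=> mh sh hu.
have h0 t w : 0 <= h t w by apply: le_trans (sh t w).
pose H w := \sum_(t < N) h t w.
have mH : measurable_fun setT H by exact: emeasurable_sum.
have H0 w : 0 <= H w by apply: sume_ge0 => t _.
(* Truncation at [0] keeps the integrand nonnegative where the union bound exceeds [1]. *)
pose phi w := maxe 0 (1 - H w).
have mphi : measurable_fun setT phi.
  by apply: measurable_maxe => //; exact: emeasurable_funB.
have phi0 w : 0 <= phi w by rewrite le_max lexx.
have intH : \int[P]_w H w = (N%:R * u)%:E.
  rewrite ge0_integral_sum//; under eq_bigr do rewrite hu.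
  by rewrite sumEFin sumr_const card_ord mulr_natl.
have phiS w : phi w <= mu w (~` \big[setU/set0]_(t < N) sync w t).
  rewrite ge_max measure_ge0/=.
  have mB : measurable (\big[setU/set0]_(t < N) sync w t).
    by apply: bigsetU_measurable => t _; exact: msync.
  have : 1 <= mu w (~` \big[setU/set0]_(t < N) sync w t) + H w.
    apply: (@le_trans _ _ (mu w setT)).
      by rewrite -setXTT product_strategy_lawE// !prob_kernel mule1.
    rewrite -(setvU (\big[setU/set0]_(t < N) sync w t)).
    apply: le_trans (measureU2 _ _ _) _ => //; first exact: measurableC.
    apply: leeD => //; apply: le_trans (Boole_inequality _ _) _ => //.
    by apply: lee_sum => t _; exact: sh.
  by case: (H w) (H0 w) => [r _| _ _|//]; [rewrite leeBlDr|rewrite addeC leNye].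
apply: (@le_trans _ _ (\int[P]_w (N.+1%:R%:E * phi w))); last first.
  apply: ge0_le_integral_nonmeasurable => w; first by rewrite mule_ge0.
  apply: le_trans (sync_time_tail w N).
  by rewrite lee_pmul2l.
rewrite ge0_integralZl// EFinM lee_pmul2l//.
(* Instead of integrating a difference, the pointwise inequality [1 <= phi + H] is integrated. *)
rewrite EFinB leeBlDr// -intH -ge0_integralD//.
apply: (@le_trans _ _ (\int[P]_w cst 1 w)).
  by rewrite integral_cst// [X in _ * X]probability_setT mule1.
apply: ge0_le_integral_nonmeasurable => // w /=.
rewrite /phi; case: (H w) (H0 w) => [r| |]// r0.
  by rewrite -leeBlDr// le_max lexx orbT.
by rewrite addey// leey.
Qed.

End lower_bound.

(** * The lower bound for Bernoulli environments *)

Section bernoulli.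
Context d (Omega : measurableType d) (R : realType) (P : probability Omega R).
Context (A B E : nat -> {RV P >-> bool}) (p1 p2 q : R).
Hypothesis ABE : bernoulli_environments p1 p2 q A B E.

Let X := env_family A B E.

Definition channel_prob (k : nat + nat + nat) : R :=
  match k with inl (inl _) => p1 | inl (inr _) => p2 | inr _ => q end.

Lemma env_family_true k : P (X k @^-1` [set true]) = (channel_prob k)%:E.
Proof.
case: ABE => _ pA pB pE.
by case: k => [[i|i]|i]; [exact: pA|exact: pB|exact: pE].
Qed.

Definition both_open k l : set Omega := [set w | X k w /\ X l w].

Lemma rectangles_both_open (K : set (nat + nat + nat)) k l :
  K k -> K l -> rectangles X K (both_open k l).
Proof.
move=> Kk Kl; rewrite (_ : both_open k l =
  X k @^-1` [set true] `&` X l @^-1` [set true])//.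
by apply: setI_closed_rectangles; exact: rectangles_preimage.
Qed.

Lemma measurable_both_open k l : measurable (both_open k l).
Proof. exact: (measurable_rectangles (@rectangles_both_open setT k l I I)). Qed.

Lemma both_open_prob k l : k != l ->
  P (both_open k l) = (channel_prob k * channel_prob l)%:E.
Proof.
move=> kl; case: (ABE) => ind _ _ _.
rewrite EFinM -!env_family_true.
apply: (independent_rectangles ind (K := [set k]) (L := [set l])).
- by apply/seteqP; split => // i [/= -> /eqP]; rewrite (negbTE kl).
- exact: rectangles_preimage.
- exact: rectangles_preimage.
Qed.

(** Applied with [c] enumerating the variables of one party: [k] and [l] lie outside, so the event
    is independent of all that this party knows. *)
Lemma independent_both_open (c : nat -> nat + nat + nat) k l S :
  ~ range c k -> ~ range c l -> measurable S ->
  independent_events P (env_at (fun i => X (c i)) @^-1` S) (both_open k l).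
Proof.
move=> ck cl mS; case: (ABE) => ind _ _ _.
apply: (independent_sigma_rectangles ind (K := range c) (L := [set k; l])).
- apply/seteqP; split => // i [ci /= il].
  by case: il => eqi; rewrite eqi in ci.
- by apply: sigma_env_at => // i; exists i.
- by apply: sub_sigma_algebra; apply: rectangles_both_open; [left|right].
Qed.

(** The bound comes from the party with the larger opening probability: its selection is independent
    of the other party's environment and of Eve's, yet must be open in both. *)
Lemma expected_sync_time_ge_bernoulli (sA sB : strategy R) (N : nat) :
  ((N.+1%:R * (1 - N%:R * (Num.min p1 p2 * q)))%:E
    <= expected_sync_time A B E sA sB)%E.
Proof.
case: (leP p1 p2) => _.
- pose U j := both_open (inl (inl j)) (inr j).
  have hU t : measurable_fun setT
      (fun w => sB (env_at B w) [set b | U (b t) w]) /\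
      (\int[P]_w sB (env_at B w) [set b | U (b t) w])%E = (p1 * q)%:E.
    apply: integral_selected_channel.
    + by move=> j; exact: measurable_both_open.
    + by move=> j; rewrite both_open_prob.
    + by move=> j S; apply: (@independent_both_open (inl \o inr)) => -[].
  apply: expected_sync_time_ge => [t|t w|t].
  + exact: (hU t).1.
  + have mU : measurable [set b : chan_space | U (b t) w].
      exact: (@measurable_seq_space_coord _ nat t [set j | U j w]).
    (* Forgetting Alice's sequence leaves a product event, of which only Bob's marginal matters. *)
    apply: (@le_trans _ _ ((strategy_law sA (env_at A w) \x
        strategy_law sB (env_at B w))%E (setT `*` [set b | U (b t) w]))).
      apply: le_measure; rewrite ?inE.
      * exact: measurable_sync_at.
      * exact: measurableX.
      * by move=> [a b] /= [j [_ <- [Aj _ Ej]]].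
    by rewrite product_strategy_lawE// prob_kernel mul1e.
  + exact: (hU t).2.
- pose U j := both_open (inl (inr j)) (inr j).
  have hU t : measurable_fun setT
      (fun w => sA (env_at A w) [set a | U (a t) w]) /\
      (\int[P]_w sA (env_at A w) [set a | U (a t) w])%E = (p2 * q)%:E.
    apply: integral_selected_channel.
    + by move=> j; exact: measurable_both_open.
    + by move=> j; rewrite both_open_prob.
    + by move=> j S; apply: (@independent_both_open (inl \o inl)) => -[].
  apply: expected_sync_time_ge => [t|t w|t].
  + exact: (hU t).1.
  + have mU : measurable [set a : chan_space | U (a t) w].
      exact: (@measurable_seq_space_coord _ nat t [set j | U j w]).
    apply: (@le_trans _ _ ((strategy_law sA (env_at A w) \x
        strategy_law sB (env_at B w))%E ([set a | U (a t) w] `*` setT))).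
      apply: le_measure; rewrite ?inE.
      * exact: measurable_sync_at.
      * exact: measurableX.
      * by move=> [a b] /= [j [<- _ [_ Bj Ej]]].
    by rewrite product_strategy_lawE// prob_kernel mule1.
  + exact: (hU t).2.
Qed.

End bernoulli.

Lemma tail_bound_optimized (R : realType) (u : R) : 0 < u ->
  exists N : nat, 4^-1 / u <= N.+1%:R * (1 - N%:R * u).
Proof.
(* This choice gives [N u <= 1/2 < (N + 1) u], so [(N + 1) u] and [1 - N u] are both at least
   [1/2]. *)
move=> u0; exists (Num.trunc (2^-1 / u)).
have v0 : 0 <= 2^-1 / u by rewrite divr_ge0 ?invr_ge0 ?ler0n ?ltW.
have /andP[] := truncn_itv v0.
set N := Num.trunc _; rewrite ler_pdivlMr// ltr_pdivrMr// => Nu N1u.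
rewrite ler_pdivrMr// mulrAC (_ : 4^-1 = 2^-1 * 2^-1); last by field.
by apply: ler_pM; rewrite ?invr_ge0 ?ler0n ?(ltW N1u)//; lra.
Qed.

(** * The strategy selecting the first open channel of a fresh row *)

(* The channel in column j of row t. *)
Definition row (t j : nat) : nat := pickle (t, j).

Lemma row_inj t j t' j' : row t j = row t' j' -> (t, j) = (t', j').
Proof. exact: (pcan_inj (@pickleK _)). Qed.

(** The value [0] on a fully closed row is arbitrary: the success events below only involve rows
    with an open channel. *)
Definition first_open (x : env_space) : chan_space := fun t =>
  match pselect (exists j, x (row t j)) with
  | left h => row t (ex_minn h)
  | right _ => 0%N
  end.

Lemma first_openE (x : env_space) t j :
  x (row t j) -> (forall i, (i < j)%N -> ~~ x (row t i)) ->
  first_open x t = row t j.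
Proof.
move=> xj xi; rewrite /first_open.
case: pselect => [h|]; last by case; exists j.
case: ex_minnP => m xm mj; congr row; apply/eqP; rewrite eqn_leq mj//=.
by rewrite leqNgt; apply/negP => /xi; rewrite xm.
Qed.

Lemma measurable_first_open : measurable_fun setT first_open.
Proof.
apply: (@measurability _ _ env_space chan_space setT first_open
  (@cylinders _ nat)) => // _ [_ [t [Y [_ ->]]] <-].
rewrite setTI.
pose O j : set env_space := [set x | x (row t j)].
have mO j : measurable (O j).
  exact: (@measurable_seq_space_coord _ bool (row t j) [set true]).
(* The selection is [row t j] when column [j] is open and all earlier ones are closed; the last
   piece accounts for the default channel [0]. *)
rewrite (_ : _ @^-1` _ =
  (\bigcup_(j in [set j | Y (row t j)]) (O j `\` \bigcup_(i in `I_j) O i)) `|`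
  (if `[< Y 0%N >] then ~` \bigcup_j O j else set0)).
  apply: measurableU.
    apply: bigcup_measurable => j _.
    by apply: measurableD => //; exact: bigcup_measurable.
  by case: ifP => // _; exact/measurableC/bigcup_measurable.
apply/seteqP; split => x /=.
  have [[j0 xj0]|nx] := pselect (exists j, x (row t j)).
    have ex : exists j, x (row t j) by exists j0.
    case: (ex_minnP ex) => j xj jmin.
    have xi i : (i < j)%N -> ~~ x (row t i).
      by move=> ij; apply/negP => /jmin; rewrite leqNgt ij.
    rewrite (first_openE xj xi) => Yj; left; exists j => //; split => //.
    by move=> [i /= ij]; apply/negP; exact: xi.
  rewrite /first_open; case: pselect => // _ Y0; right.
  by rewrite asboolT// => -[j _ xj]; apply: nx; exists j.
move=> [[j /= Yj [xj nxj]]|].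
  rewrite (@first_openE _ _ j)// => i ij.
  by apply/negP => xi; apply: nxj; exists i.
case: asboolP => // Y0 nx; rewrite /first_open; case: pselect => //.
by move=> [j xj]; exfalso; apply: nx; exists j.
Qed.

Definition first_open_strategy (R : realType) : strategy R :=
  kdirac measurable_first_open.

(** * Measurability of the synchronization time and its value under deterministic strategies *)

Section sync_time_measurable.
Context (R : realType).
Local Open Scope ereal_scope.

Lemma measurable_sync_time (A B E : env_space) :
  measurable_fun setT (fun ab : chan_space * chan_space =>
    sync_time R A B E ab.1 ab.2).
Proof.
(* Giving the value [+oo] to slots without synchronization turns an infimum over a set depending on
   [ab] into a countable infimum of measurable functions. *)
pose f t (ab : chan_space * chan_space) : \bar R :=
  if `[< sync_at A B E ab.1 ab.2 t >] then t.+1%:R%:E else +oo.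
rewrite (_ : (fun _ => _) = fun ab => einfs (f ^~ ab) 0%N).
  apply: measurable_fun_einfs => t; apply: measurable_fun_ifT => //.
  apply: (measurable_fun_bool true); rewrite setTI.
  rewrite (_ : _ @^-1` _ = [set ab | sync_at A B E ab.1 ab.2 t]).
    exact: measurable_sync_at.
  by apply/seteqP; split => ab /= /asboolP.
apply/funext => ab; apply/eqP; rewrite eq_le; apply/andP; split.
  apply: le_ereal_inf_tmp => _ [t _ <-]; rewrite /f; case: asboolP => st.
    by apply: ereal_inf_lbound; exists t.
  exact: leey.
apply: le_ereal_inf_tmp => _ [t st <-]; apply: ge_ereal_inf.
by exists (f t ab); [exists t|rewrite /f asboolT].
Qed.

(** Both laws are Dirac measures, so Tonelli's theorem reduces the integral to a point
    evaluation. *)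
Lemma integral_first_open_strategy (A B E : env_space) :
  \int[strategy_law (first_open_strategy R) A \x
       strategy_law (first_open_strategy R) B]_ab sync_time R A B E ab.1 ab.2 =
  sync_time R A B E (first_open A) (first_open B).
Proof.
have mf := @measurable_sync_time A B E.
have f0 (ab : chan_space * chan_space) : 0 <= sync_time R A B E ab.1 ab.2.
  by apply: le_ereal_inf_tmp => _ [t _ <-]; rewrite lee_fin.
rewrite fubini_tonelli1//.
transitivity (\int[\d_(first_open A)]_a \int[\d_(first_open B)]_b
  sync_time R A B E a b); first by [].
have mfa a : measurable_fun setT (fun b : chan_space => sync_time R A B E a b).
  exact: (measurableT_comp mf (measurable_pair1 a)).
under eq_integral do rewrite integral_dirac// diracT mul1e.
rewrite integral_dirac ?diracT ?mul1e//.
exact: (measurableT_comp mf (measurable_pair2 (first_open B))).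
Qed.

End sync_time_measurable.

(** * Upper bound: independent rows and the geometric tail *)

Section upper_bound.
Context d (Omega : measurableType d) (R : realType) (P : probability Omega R).
Context (A B E : nat -> {RV P >-> bool}) (p1 p2 q : R).
Hypothesis ABE : bernoulli_environments p1 p2 q A B E.

Let X := env_family A B E.

Definition channel_of (k : nat + nat + nat) : nat :=
  match k with inl (inl i) => i | inl (inr i) => i | inr i => i end.

(** The variables on which success in the slots of [T] depends; disjoint sets of slots use disjoint
    variables, whence independence. *)
Definition row_variables (T : set nat) : set (nat + nat + nat) :=
  [set k | exists t j, T t /\ channel_of k = row t j].

Lemma row_variables_disjoint S T : S `&` T = set0 ->
  row_variables S `&` row_variables T = set0.
Proof.
move=> ST; apply/seteqP; split => // k [[s [i [Ss ks]]] [t [j [Tt kt]]]].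
have [st _] := row_inj (etrans (esym ks) kt).
have : (S `&` T) s by split => //; rewrite st.
by rewrite ST.
Qed.

(** Column [j] is the first open one of row [t] for both parties at once, so both select it. Fixing
    the column makes the event finite-dimensional. *)
Definition success_at (t j : nat) : set Omega :=
  [set w | [/\ A (row t j) w, B (row t j) w, E (row t j) w &
    forall i, (i < j)%N -> ~~ A (row t i) w /\ ~~ B (row t i) w]].

Let variables_at (t j : nat) : seq (nat + nat + nat) :=
  [seq inl (inl (row t i)) | i <- iota 0 j.+1] ++
  [seq inl (inr (row t i)) | i <- iota 0 j.+1] ++ [:: inr (row t j)].

(* Open exactly at the j-th channel of row t, among its first j.+1 channels. *)
Let pattern_at (t j : nat) (k : nat + nat + nat) : set bool :=
  [set b | b = (channel_of k == row t j)].

(** This rectangle form lets mutual independence compute the probability. *)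
Let success_atE t j : success_at t j =
  \bigcap_(k in [set` variables_at t j]) (X k @^-1` pattern_at t j k).
Proof.
have row_neq i : (i < j)%N -> (row t i == row t j) = false.
  move=> ij; apply/eqP => /row_inj [ij']; by rewrite ij' ltnn in ij.
apply/seteqP; split => w /=.
  move=> [Aj Bj Ej ABi] k; rewrite /= !mem_cat.
  have cases i : i \in iota 0 j.+1 -> i = j \/ (i < j)%N.
    by rewrite mem_iota leq0n add0n ltnS leq_eqVlt => /orP[/eqP|];
      [left|right].
  move=> /or3P[/mapP[i /cases ij ->]|/mapP[i /cases ij ->]|];
    rewrite /pattern_at /=.
  - case: ij => [->|ij]; first by rewrite eqxx.
    by rewrite row_neq//; apply/negbTE; case: (ABi i ij).
  - case: ij => [->|ij]; first by rewrite eqxx.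
    by rewrite row_neq//; apply/negbTE; case: (ABi i ij).
  - by rewrite mem_seq1 => /eqP -> /=; rewrite eqxx.
move=> h.
have hA i : (i <= j)%N -> A (row t i) w = (row t i == row t j).
  move=> ij; apply: (h (inl (inl (row t i)))) => /=; rewrite mem_cat.
  apply/orP; left; apply/mapP; exists i => //.
  by rewrite mem_iota add0n ltnS ij.
have hB i : (i <= j)%N -> B (row t i) w = (row t i == row t j).
  move=> ij; apply: (h (inl (inr (row t i)))) => /=; rewrite !mem_cat.
  apply/or3P; apply: Or32; apply/mapP; exists i => //.
  by rewrite mem_iota add0n ltnS ij.
split.
- by rewrite hA.
- by rewrite hB.
- have := h (inr (row t j)); rewrite /pattern_at /= eqxx; apply.
  by rewrite !mem_cat; apply/or3P; apply: Or33; rewrite inE.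
- by move=> i ij; rewrite hA ?hB ?(ltnW ij)// row_neq.
Qed.

Let uniq_variables_at t j : uniq (variables_at t j).
Proof.
have rinj : injective (row t) by move=> i i' /row_inj [].
rewrite /variables_at !cat_uniq; apply/and3P; split.
- by rewrite map_inj_uniq ?iota_uniq// => i i' [/rinj].
- apply/hasPn => k; rewrite mem_cat mem_seq1 => /orP[/mapP[i _ ->]|/eqP ->];
    by apply/mapP => -[].
- apply/and3P; split => //.
    by rewrite map_inj_uniq ?iota_uniq// => i i' [/rinj].
  by apply/hasPn => k; rewrite inE => /eqP ->; apply/mapP => -[].
Qed.

Lemma rectangles_success_at t j :
  rectangles X (row_variables [set t]) (success_at t j).
Proof.
exists (variables_at t j), (pattern_at t j); split => //.
  move=> k /=; rewrite !mem_cat mem_seq1.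
  move=> /or3P[/mapP[i _ ->]|/mapP[i _ ->]|/eqP ->].
  - by exists t, i.
  - by exists t, i.
  - by exists t, j.
Qed.

Lemma measurable_success_at t j : measurable (success_at t j).
Proof. exact: (measurable_rectangles (@rectangles_success_at t j)). Qed.

Lemma env_family_false k :
  P (X k @^-1` [set false]) = (1 - channel_prob p1 p2 q k)%:E.
Proof.
rewrite (_ : X k @^-1` [set false] = ~` (X k @^-1` [set true])); last first.
  by apply/seteqP; split => w /=; case: (X k w).
rewrite probability_setC ?(env_family_true ABE)//.
by rewrite -[X in measurable X]setTI; exact: measurable_funP.
Qed.

(** Each party contributes [j] closed channels and an open one, Eve a single open one. *)
Lemma success_at_prob t j :
  P (success_at t j) = (((1 - p1) * (1 - p2)) ^+ j * (p1 * p2 * q))%:E.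
Proof.
have row_neq i : (i < j)%N -> (row t i == row t j) = false.
  by move=> ij; apply/eqP => /row_inj [ij']; rewrite ij' ltnn in ij.
have patT k : channel_of k == row t j ->
    P (X k @^-1` pattern_at t j k) = (channel_prob p1 p2 q k)%:E.
  by move=> kt; rewrite -(env_family_true ABE) /pattern_at kt.
have patF k : (channel_of k == row t j) = false ->
    P (X k @^-1` pattern_at t j k) = (1 - channel_prob p1 p2 q k)%:E.
  by move=> kt; rewrite -env_family_false /pattern_at kt.
have prodE (c : nat -> nat + nat + nat) (p : R) :
    (forall i, channel_of (c i) = row t i) ->
    (forall i, channel_prob p1 p2 q (c i) = p) ->
    (\prod_(k <- [seq c i | i <- iota 0 j.+1])
       P (X k @^-1` pattern_at t j k))%E = ((1 - p) ^+ j * p)%:E.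
  move=> cr cp; rewrite big_map -[j.+1]subn0 -/(index_iota 0 j.+1).
  rewrite big_nat_recr//= patT ?cr// cp EFinM; congr (_ * _)%E.
  rewrite (eq_big_nat _ _ (F2 := fun=> (1 - p)%:E)); last first.
    by move=> i /andP[_ ij]; rewrite patF ?cp// cr row_neq.
  by rewrite prodEFin prodr_const_nat subn0.
case: (ABE) => ind _ _ _; rewrite success_atE ind//.
rewrite !big_cat/= big_seq1 patT//=.
rewrite (prodE _ p1)// (prodE _ p2)// -!EFinM; congr (_%:E).
by rewrite exprMn; ring.
Qed.

Definition success (t : nat) : set Omega := \bigcup_j success_at t j.

Lemma sigma_success t :
  <<s rectangles X (row_variables [set t]) >> (success t).
Proof.
apply: sigma_algebra_bigcup => j.
by apply: sub_sigma_algebra; exact: rectangles_success_at.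
Qed.

Lemma measurable_success t : measurable (success t).
Proof. by apply: bigcup_measurable => j _; exact: measurable_success_at. Qed.

Lemma success_prob_ge t (J : nat) :
  ((\sum_(j < J) ((1 - p1) * (1 - p2)) ^+ j * (p1 * p2 * q))%:E
    <= P (success t))%E.
Proof.
rewrite /success measure_bigcup//; last 2 first.
- by move=> j _; exact: measurable_success_at.
(* For two distinct columns, the event at the later one closes the earlier one for Alice, while the
   event at the earlier one opens it. *)
- apply: ltn_trivIset => i j ij; apply/seteqP; split => // w.
  move=> [[Ai _ _ _] [_ _ _ Aj]].
  by have [/negP] := Aj _ ij.
rewrite (eq_eseriesl (Q := xpredT)); last by move=> j; rewrite in_setT.
rewrite -sumEFin -(big_mkord xpredT (fun j =>
  (((1 - p1) * (1 - p2)) ^+ j * (p1 * p2 * q))%:E)).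
under eq_bigr do rewrite -(success_at_prob t).
by apply: nneseries_lim_ge => j _ _; exact: measure_ge0.
Qed.

Definition no_success (n : nat) : set Omega :=
  ~` \bigcup_(t in `I_n) success t.

Lemma sigma_no_success n :
  <<s rectangles X (row_variables `I_n) >> (no_success n).
Proof.
apply: sigma_algebraC; rewrite bigcup_mkcond; apply: sigma_algebra_bigcup => t.
case: ifPn => [/set_mem tn|_]; last exact: sigma_algebra0.
apply: sub_sigma_algebra2 (@sigma_success t) => F.
move=> [s [Y [us sK mY ->]]]; exists s, Y; split => // k /sK [t' [j [-> kE]]].
by exists t, j.
Qed.

Lemma measurable_no_success n : measurable (no_success n).
Proof.
apply: measurableC; apply: bigcup_measurable => t _.
exact: measurable_success.
Qed.

(** Success in slot [n] depends on row [n] only, hence is independent of the earlier rows; each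
    induction step gains a factor [1 - r]. *)
Lemma no_success_prob (r : R) n : 0 <= r -> r <= 1 ->
  (forall t, (r%:E <= P (success t))%E) ->
  (P (no_success n) <= ((1 - r) ^+ n)%:E)%E.
Proof.
move=> r0 r1 rS; elim: n => [|n ih].
  by rewrite expr0; apply: probability_le1; exact: measurable_no_success.
have -> : no_success n.+1 = no_success n `&` ~` success n.
  by rewrite /no_success IIS bigcup_setU bigcup_set1 setCU.
have : independent_events P (~` success n) (no_success n).
  case: (ABE) => ind _ _ _.
  apply: (independent_sigma_rectangles ind
    (K := row_variables [set n]) (L := row_variables `I_n)).
  - apply: row_variables_disjoint; apply/seteqP; split => // i [/= -> ].
    by rewrite ltnn.
  - by apply: sigma_algebraC; exact: sigma_success.
  - exact: sigma_no_success.
rewrite /independent_events setIC => ->; rewrite exprS EFinM.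
apply: lee_pmul => //.
rewrite probability_setC; last exact: measurable_success.
by rewrite EFinB leeB.
Qed.

(** Tail-sum bound. If the first success has index [t], the terms [n = 0, ..., t] all equal [1] and
    cover the time [t + 1]; without success the series diverges. *)
Lemma sync_time_le_no_success w :
  (sync_time R (env_at A w) (env_at B w) (env_at E w)
     (first_open (env_at A w)) (first_open (env_at B w))
   <= \sum_(n <oo) (\1_(no_success n) w)%:E)%E.
Proof.
have ind_ge0 n : (0 <= (\1_(no_success n) w)%:E :> \bar R)%E by rewrite lee_fin.
have partial m : (forall n, (n < m)%N -> no_success n w) ->
    (m%:R%:E <= \sum_(n <oo) (\1_(no_success n) w)%:E :> \bar R)%E.
  move=> nm; apply: le_trans (nneseries_lim_ge m (fun n _ _ => ind_ge0 n)).
  rewrite (eq_big_nat _ _ (F2 := fun=> 1%:E)).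
    by rewrite sumEFin sumr_const_nat subn0.
  by move=> n /andP[_ /nm nw]; rewrite indicE mem_set.
have [[t0 st0]|ns] := pselect (exists t, success t w); last first.
  rewrite [leRHS](_ : _ = +oo%E) ?leey//; apply/eqyP => a a0.
  have /andP[_ /ltW at1] := truncn_itv (ltW a0).
  apply: le_trans (partial (Num.trunc a).+1 _); first by rewrite lee_fin.
  by move=> n _ [t _ st]; apply: ns; exists t.
have ex : exists t, `[< success t w >] by exists t0; apply/asboolP.
case: (ex_minnP ex) => t /asboolP [j _ [Aj Bj Ej ABi]] tmin.
apply: le_trans (partial t.+1 _); last first.
  move=> n; rewrite ltnS => nt [s /= sn /asboolP/tmin ts].
  by have := leq_ltn_trans ts (leq_trans sn nt); rewrite ltnn.
apply: ge_ereal_inf; exists t.+1%:R%:E => //; exists t => //.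
exists (row t j); split => //; apply: first_openE => // i /ABi[]//.
Qed.

(** Integrating the tail sum term by term leaves at most a geometric series of ratio [1 - r], with
    sum [1 / r]. *)
Lemma expected_sync_time_first_open (r : R) : 0 < r -> r <= 1 ->
  (forall t, (r%:E <= P (success t))%E) ->
  (expected_sync_time A B E (first_open_strategy R) (first_open_strategy R)
    <= r^-1%:E)%E.
Proof.
move=> r0 r1 rS; rewrite /expected_sync_time.
under eq_integral do rewrite integral_first_open_strategy.
apply: le_trans (ge0_le_integral_nonmeasurable _ _ sync_time_le_no_success) _.
  by move=> w; apply: le_ereal_inf_tmp => _ [t _ <-]; rewrite lee_fin.
rewrite integral_nneseries//; last first.
  by move=> n; apply/measurable_EFinP/measurable_indic/measurable_no_success.
apply: lime_le.
  apply: is_cvg_nneseries => n _ _.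
  by apply: integral_ge0 => w _; rewrite lee_fin.
apply: nearW => m.
apply: (@le_trans _ _ (\sum_(0 <= n < m) ((1 - r) ^+ n)%:E)%E).
  apply: lee_sum => n _.
  rewrite integral_indic ?setIT//; last exact: measurable_no_success.
  by apply: no_success_prob => //; exact: ltW.
rewrite sumEFin lee_fin big_mkord -[leRHS]mul1r ler_pdivlMr//.
(* The finite geometric sum times [r] equals [1 - (1 - r)^m], which is at most [1]. *)
have := subrX1 (1 - r) m.
have : 0 <= (1 - r) ^+ m by rewrite exprn_ge0 ?subr_ge0.
by lra.
Qed.

End upper_bound.

(** * Choice of constants and conclusion *)

(** With [x = (1 - p1) (1 - p2)], the bound [1 - x <= 2 max(p1, p2)] costs one factor [2], and
    stopping the series once [x^J <= 1/2] costs another. *)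
Lemma success_prob_lower (R : realType) (p1 p2 q : R) :
  0 < p1 <= 1 -> 0 < p2 <= 1 -> 0 < q <= 1 ->
  exists J : nat, Num.min p1 p2 * q / 4 <=
    \sum_(j < J) ((1 - p1) * (1 - p2)) ^+ j * (p1 * p2 * q).
Proof.
move=> /andP[p10 p11] /andP[p20 p21] /andP[q0 q1].
set x := (1 - p1) * (1 - p2).
have x0 : 0 <= x by rewrite mulr_ge0 ?subr_ge0.
have xE : 1 - x = p1 + p2 - p1 * p2 by rewrite /x; ring.
have p12 : 0 < p1 * p2 by rewrite mulr_gt0.
have p12' : p1 * p2 <= p1 by rewrite ler_piMr// ltW.
have x1 : `|x| < 1 by rewrite ger0_norm//; lra.
have /cvgrPdist_le /(_ 2^-1) := cvg_expr x1.
case=> [|J _ /(_ J (leqnn J))]; first by rewrite invr_gt0.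
rewrite sub0r normrN ger0_norm ?exprn_ge0// => xJ.
exists J; rewrite -mulr_suml; set S := \sum_(j < J) _.
have S0 : 0 <= S by apply: sumr_ge0 => j _; rewrite exprn_ge0.
(* This is [(1 - x) S = 1 - x^J >= 1/2]. *)
have eS : 2^-1 <= (p1 + p2 - p1 * p2) * S.
  by rewrite -xE; have := subrX1 x J; rewrite -/S; lra.
rewrite !mulrA mulrAC ler_pM2r//; case: (leP p1 p2) => p.
- have : 2^-1 <= 2 * p2 * S by apply: le_trans eS _; rewrite ler_wpM2r//; lra.
  by move=> ?; have : p1 * 4^-1 <= p1 * (p2 * S); [rewrite ler_pM2l//|]; lra.
- have : 2^-1 <= 2 * p1 * S by apply: le_trans eS _; rewrite ler_wpM2r//; lra.
  by move=> ?; have : p2 * 4^-1 <= p2 * (p1 * S); [rewrite ler_pM2l//|]; lra.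
Qed.

Theorem theorem2 (R : realType) :
  exists C c : R, 0 < C /\ 0 < c /\
    forall p1 p2 q : R,
      0 < p1 <= 1 -> 0 < p2 <= 1 -> 0 < q <= 1 ->
      (exists sA sB : strategy R,
        forall (d : measure_display) (Omega : measurableType d)
          (P : probability Omega R) (A B E : nat -> {RV P >-> bool}),
          bernoulli_environments p1 p2 q A B E ->
          (expected_sync_time A B E sA sB
             <= (C / (Num.min p1 p2 * q))%:E)%E)
      /\
      (forall sA sB : strategy R,
        forall (d : measure_display) (Omega : measurableType d)
          (P : probability Omega R) (A B E : nat -> {RV P >-> bool}),
          bernoulli_environments p1 p2 q A B E ->
          ((c / (Num.min p1 p2 * q))%:E
             <= expected_sync_time A B E sA sB)%E).
Proof.
(* With [u = min(p1, p2) q], [4] comes from the success probability [u / 4] per slot, and [4^-1]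
   from the two factors [1/2] in [tail_bound_optimized]. *)
exists 4, 4^-1; split; first by []; split; first by rewrite invr_gt0.
move=> p1 p2 q hp1 hp2 hq.
have u0 : 0 < Num.min p1 p2 * q.
  case/andP: hp1 => p10 _; case/andP: hp2 => p20 _; case/andP: hq => q0 _.
  by rewrite mulr_gt0// lt_min p10.
have u1 : Num.min p1 p2 * q <= 1.
  case/andP: hp1 => p10 p11; case/andP: hp2 => p20 _; case/andP: hq => q0 q1.
  by rewrite mulr_ile1 ?le_min ?(ltW p10) ?(ltW p20) ?(ltW q0)// ge_min p11.
split.
(* The strategies do not depend on [p1], [p2], [q]; the truncation [J] enters only the estimate. *)
- exists (first_open_strategy R), (first_open_strategy R).
  move=> d Omega P A B E ABE.
  have [J hJ] := success_prob_lower hp1 hp2 hq.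
  rewrite -[4 / _]invf_div.
  apply: (expected_sync_time_first_open ABE); [by rewrite divr_gt0|lra|].
  by move=> t; apply: le_trans (success_prob_ge ABE t J); rewrite lee_fin.
- move=> sA sB d Omega P A B E ABE.
  have [N hN] := tail_bound_optimized u0.
  apply: le_trans (expected_sync_time_ge_bernoulli ABE sA sB N).
  by rewrite lee_fin.
Qed.
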